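(* Let $k\geqslant 1$ be an integer and let $G$ be an arbitrary graph with $|V(G)|\geqslant k$. Then $$\gamma_{k\text{-SRD}}(G)\leqslant\gamma_{kR}(G)\leqslant 2\gamma_k(G).$$
   Context: All graphs are finite, simple and undirected; $N(v)$ denotes the set of neighbors of $v$ and $\Delta(G)$ the maximum degree. Let $k\geqslant 1$ be an integer with $|V(G)|\geqslant k$. An attack pattern is a set $P\subseteq V(G)$ with $|P|=k$. A function $f:V(G)\to\{0,1,\ldots,\min(\Delta(G),k)+1\}$ is a proper $k$-SRD ($k$-strong Roman domination) function if for each attack pattern $P$ every vertex $u\in P$ with $f(u)=0$ can be defended by a neighboring vertex, where each vertex $v$ with $f(v)\geqslant 2$ can defend at most $f(v)-1$ of its neighbors in $P$ labeled 0 (and vertices with label $\leqslant 1$ defend no other vertex). That is, for each $P$ there is a map $\delta_P:\{u\in P : f(u)=0\}\to V(G)$ (which may depend on $P$) such that $\delta_P(u)\in N(u)$ and $f(\delta_P(u))\geqslant 2$ for all $u$ in its domain, and $|\delta_P^{-1}(v)|\leqslant f(v)-1$ for every $v$ with $f(v)\geqslant 2$. The weight is $\omega(f)=\sum_{v\in V(G)}f(v)$, and the $k$-SRD number is $\gamma_{k\text{-SRD}}(G)=\min\{\omega(f) : f \text{ is a proper } k\text{-SRD function on } G\}$. A Roman $k$-dominating function on $G$ is a function $f:V(G)\to\{0,1,2\}$ such that every vertex labeled 0 is adjacent to at least $k$ vertices labeled 2. The Roman $k$-domination number $\gamma_{kR}(G)$ is the minimum weight $\sum_{v\in V(G)}f(v)$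 of a Roman $k$-dominating function on $G$. A set $D\subseteq V(G)$ is a $k$-dominating set if every vertex $v\in V(G)\setminus D$ satisfies $|N(v)\cap D|\geqslant k$. The $k$-domination number $\gamma_k(G)$ is the minimum cardinality of a $k$-dominating set of $G$. *)

(* Defs.v *)
From mathcomp Require Import all_boot.

Set Implicit Arguments.
Unset Strict Implicit.
Unset Printing Implicit Defensive.

(* A finite simple graph is a finite type T of vertices with a symmetric,
   irreflexive adjacency relation e : rel T. *)

Definition nbhd (T : finType) (e : rel T) (v : T) : {set T} := [set u | e v u].

Definition max_degree (T : finType) (e : rel T) : nat := \max_(v : T) #|nbhd e v|.

Definition weight (T : finType) (m : nat) (f : {ffun T -> 'I_m}) : nat :=
  \sum_(v : T) f v.

Definition all_one (T : finType) (m : nat) : {ffun T -> 'I_m.+2} :=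
  [ffun=> @Ordinal m.+2 1 isT].

Definition srd_labelling (T : finType) (e : rel T) (k : nat) : finType :=
  {ffun T -> 'I_(minn (max_degree e) k).+2}.

Section Defense.
Variables (T : finType) (e : rel T) (m : nat) (f : {ffun T -> 'I_m}).

Definition attacked_zeros (P : {set T}) : {set T} :=
  [set u in P | f u == 0 :> nat].

(* The defense map delta is defined on all of T, but only its values on
   attacked_zeros P matter. *)
Definition is_defense (P : {set T}) (delta : {ffun T -> T}) : bool :=
  [forall u in attacked_zeros P,
     (delta u \in nbhd e u) && (2 <= f (delta u))] &&
  [forall v, (2 <= f v) ==>
     (#|[set u in attacked_zeros P | delta u == v]| <= f v - 1)].

End Defense.

Definition proper_srd (T : finType) (e : rel T) (k : nat)
    (f : srd_labelling e k) : bool :=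
  [forall P : {set T}, (#|P| == k) ==>
     [exists delta : {ffun T -> T}, is_defense e f P delta]].

(* In the three [arg min] expressions of this file the starting point is always
   admissible, so each number is the true minimum (see srd_numberP,
   roman_kdom_numberP and kdom_numberP). *)
Definition srd_number (T : finType) (e : rel T) (k : nat) : nat :=
  weight [arg min_(f < all_one T (minn (max_degree e) k) | proper_srd (k := k) f)
            weight f].

Definition roman_kdominating (T : finType) (e : rel T) (k : nat)
    (f : {ffun T -> 'I_3}) : bool :=
  [forall v, (f v == 0 :> nat) ==>
     (k <= #|[set u in nbhd e v | f u == 2 :> nat]|)].

Definition roman_kdom_number (T : finType) (e : rel T) (k : nat) : nat :=
  weight [arg min_(f < all_one T 1 | roman_kdominating e k f) weight f].

Definition kdominating (T : finType) (e : rel T) (k : nat) (D : {set T}) : bool :=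
  [forall v in ~: D, k <= #|nbhd e v :&: D|].

Definition kdom_number (T : finType) (e : rel T) (k : nat) : nat :=
  #|[arg min_(D < [set: T] | kdominating e k D) #|D|]|.

Section WellDefined.
Variables (T : finType) (e : rel T) (k : nat).

Lemma proper_srd_all_one :
  proper_srd (k := k) (all_one T (minn (max_degree e) k) : srd_labelling e k).
Proof.
apply/forallP => P; apply/implyP => _; apply/existsP; exists [ffun u => u].
apply/andP; split.
  by apply/forallP => u; apply/implyP; rewrite inE !ffunE andbF.
by apply/forallP => v; rewrite ffunE.
Qed.

Lemma roman_kdominating_all_one : roman_kdominating e k (all_one T 1).
Proof. by apply/forallP => v; rewrite ffunE. Qed.

Lemma kdominating_setT : kdominating e k [set: T].
Proof. by apply/forallP => v; rewrite !inE. Qed.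

Lemma srd_numberP :
  (exists2 f : srd_labelling e k, proper_srd f & weight f = srd_number e k) /\
  (forall f : srd_labelling e k, proper_srd f -> srd_number e k <= weight f).
Proof.
rewrite /srd_number; case: arg_minnP => [|f pf minf].
  exact: proper_srd_all_one.
by split; [exists f | exact: minf].
Qed.

Lemma roman_kdom_numberP :
  (exists2 f : {ffun T -> 'I_3},
     roman_kdominating e k f & weight f = roman_kdom_number e k) /\
  (forall f : {ffun T -> 'I_3},
     roman_kdominating e k f -> roman_kdom_number e k <= weight f).
Proof.
rewrite /roman_kdom_number; case: arg_minnP => [|f pf minf].
  exact: roman_kdominating_all_one.
by split; [exists f | exact: minf].
Qed.

Lemma kdom_numberP :
  (exists2 D : {set T}, kdominating e k D & #|D| = kdom_number e k) /\
  (forall D : {set T}, kdominating e k D -> kdom_number e k <= #|D|).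
Proof.
rewrite /kdom_number; case: arg_minnP => [|D pD minD].
  exact: kdominating_setT.
by split; [exists D | exact: minD].
Qed.

End WellDefined.

(* Main.v *)
Require Import Defs.
From mathcomp Require Import all_boot.

(** A vertex labeled 0 by a Roman [k]-dominating function has at least [k]
    neighbors labeled 2, and an attack has at most [k] such vertices, so a greedy
    choice gives the attacked zeros pairwise distinct defenders.  Labeling a
    [k]-dominating set by 2 gives the second inequality. *)

Lemma greedy_transversal (T : finType) (S : T -> {set T}) (s : seq T) :
  {in s, forall u, size s <= #|S u|} ->
  exists d : {ffun T -> T},
    {in s, forall u, d u \in S u} /\ {in s &, injective d}.
Proof.
elim: s => [|x s IHs] leS; first by exists [ffun u => u].
have [u us|d [dS d_inj]] := IHs.
  by apply: ltnW; apply: leS; rewrite inE us orbT.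
(* A repeated entry keeps the value it already has. *)
have [xs|xNs] := boolP (x \in s).
  have in_s u : u \in x :: s -> u \in s by rewrite inE => /predU1P[->|].
  exists d; split=> [u /in_s /dS //|u v /in_s us /in_s vs]; exact: d_inj.
have /subsetPn[y yS yNd] : ~~ (S x \subset [seq d u | u <- s]).
  apply/negP => /subset_leq_card le_S.
  have := leq_trans (leS x (mem_head x s)) (leq_trans le_S (card_size _)).
  by rewrite size_map ltnn.
have yNdu u : u \in s -> y != d u.
  by move=> us; apply: contraNneq yNd => ->; apply: map_f.
have neq_x u : u \in s -> (u == x) = false.
  by move=> us; apply: contraNF xNs => /eqP <-.
exists [ffun u => if u == x then y else d u]; split=> [u|u v].
  by rewrite inE ffunE => /predU1P[->|us]; rewrite ?eqxx // neq_x // dS.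
rewrite !inE !ffunE => /predU1P[->|us] /predU1P[->|vs]; rewrite ?eqxx ?neq_x //.
- by move=> yd; have := yNdu _ vs; rewrite yd eqxx.
- by move=> dy; have := yNdu _ us; rewrite dy eqxx.
- exact: d_inj.
Qed.

(* The cap matters only when [minn (max_degree e) k = 0], where label 2 is not
   available. *)
Definition cap_labelling (T : finType) (e : rel T) (k : nat)
    (f : {ffun T -> 'I_3}) : srd_labelling e k :=
  [ffun v => inord (minn (f v) (minn (max_degree e) k).+1)].

Lemma cap_labellingE (T : finType) (e : rel T) (k : nat)
    (f : {ffun T -> 'I_3}) (v : T) :
  cap_labelling T e k f v = minn (f v) (minn (max_degree e) k).+1 :> nat.
Proof. by rewrite ffunE inordK // ltnS geq_minr. Qed.

Lemma proper_srd_cap_labelling (T : finType) (e : rel T) (k : nat)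
    (f : {ffun T -> 'I_3}) :
  1 <= k -> roman_kdominating e k f -> proper_srd (cap_labelling T e k f).
Proof.
move=> k_gt0 /forallP fdom; apply/forallP => P; apply/implyP => /eqP cardP.
set g := cap_labelling T e k f; set A := attacked_zeros g P.
pose S u := [set w in nbhd e u | f w == 2 :> nat].
have leS u : u \in A -> k <= #|S u|.
  rewrite inE cap_labellingE => /andP[_ /eqP fu0].
  (* The cap is at least 1, so it creates no new zeros. *)
  apply: (implyP (fdom u)); move: fu0.
  by case: (nat_of_ord (f u)) => [|n] //; rewrite minnSS.
have leA : size (enum A) <= k.
  rewrite -cardE -cardP; apply/subset_leq_card/subsetP => u.
  by rewrite inE => /andP[].
have [u|d [dS d_inj]] := greedy_transversal T S (enum A).
  by rewrite mem_enum => uA; apply: leq_trans leA (leS u uA).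
apply/existsP; exists d; apply/andP; split.
  apply/forall_inP => u uA; have := dS u.
  rewrite mem_enum => /(_ uA); rewrite inE => /andP[du /eqP fdu].
  (* The label 2 of [d u] survives the cap: [u] has a neighbor, so the maximum degree is positive,
     and [k] is positive too. *)
  rewrite du cap_labellingE fdu leq_min /=.
  rewrite ltnS leq_min k_gt0 andbT.
  apply: leq_trans (leq_bigmax u); apply/card_gt0P.
  by exists (d u).
apply/forallP => v; apply/implyP => gv_ge2.
(* Distinct attacked zeros have distinct defenders, so [v] defends at most one of them, and a label
   of at least 2 allows for one. *)
apply: (@leq_trans 1); last by rewrite leq_subRL // ltnW.
apply/card_le1_eqP => u w; rewrite !inE => /andP[uA /eqP du] /andP[wA /eqP dw].
by apply: d_inj; rewrite ?mem_enum ?inE // du dw.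
Qed.

Lemma srd_number_le_roman (T : finType) (e : rel T) (k : nat) :
  1 <= k -> srd_number e k <= roman_kdom_number e k.
Proof.
move=> k_gt0; have [[f fdom <-] _] := roman_kdom_numberP e k.
have [_ /(_ _ (proper_srd_cap_labelling T e k f k_gt0 fdom))] := srd_numberP e k.
(* Capping never raises a label, so the weight does not grow. *)
move/leq_trans; apply; apply: leq_sum => v _.
by rewrite cap_labellingE geq_minl.
Qed.

Lemma roman_le_double_kdom (T : finType) (e : rel T) (k : nat) :
  roman_kdom_number e k <= 2 * kdom_number e k.
Proof.
have [[D /forall_inP Ddom <-] _] := kdom_numberP e k.
pose f : {ffun T -> 'I_3} := [ffun v => if v \in D then inord 2 else ord0].
have fE v : f v = (if v \in D then 2 else 0) :> nat.
  by rewrite ffunE; case: ifP; rewrite // inordK.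
have fdom : roman_kdominating e k f.
  apply/forallP => v; apply/implyP; rewrite fE.
  case: ifP => // vND _; have := Ddom v; rewrite inE vND => /(_ isT).
  (* The neighbors of [v] in [D] all carry the label 2. *)
  move/leq_trans; apply; apply/subset_leq_card/subsetP => u.
  by rewrite !inE fE => /andP[-> ->].
have [_ /(_ _ fdom)/leq_trans] := roman_kdom_numberP e k; apply.
rewrite /weight (eq_bigr _ (fun v _ => fE v)) -big_mkcond /= sum_nat_const.
by rewrite mulnC.
Qed.

Theorem corollary1 (T : finType) (e : rel T)
    (e_sym : symmetric e) (e_irr : irreflexive e)
    (k : nat) (k_ge1 : 1 <= k) (k_le_card : k <= #|T|) :
  srd_number e k <= roman_kdom_number e k /\
  roman_kdom_number e k <= 2 * kdom_number e k.
Proof.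
split; [exact: srd_number_le_roman | exact: roman_le_double_kdom].
Qed.
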